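(* Let $Y_1,Y_2,\ldots$ be independent copies of a random variable $Y$, let $\{g(\cdot;\theta):\theta\in\Theta\}$ be a model for the density of $Y$ (not necessarily correctly specified), and put $$L_n(\theta)=\prod_{i=1}^n g(Y_i;\theta),\qquad l_\infty(\theta)=E\log g(Y;\theta).$$ Let $\Theta_1,\Theta_2$ be subsets of $\Theta$. If the collection of functions $\{\log g(Y;\theta):\theta\in\Theta_j\}$ is Glivenko-Cantelli for $j=1,2$, then, with probability 1, as $n\to\infty$, $$\frac{\sup L_n(\Theta_1)}{\sup L_n(\Theta_2)}\to\begin{cases}\infty & \text{if }\sup l_\infty(\Theta_1)>\sup l_\infty(\Theta_2),\\ 0 & \text{if }\sup l_\infty(\Theta_1)<\sup l_\infty(\Theta_2).\end{cases}$$
   Context: For a function $F$ on $\Theta$ and $A\subset\Theta$, $F(A)=\{F(\theta):\theta\in A\}$, so $\sup L_n(\Theta_j)=\sup_{\theta\in\Theta_j}L_n(\theta)$ and $\sup l_\infty(\Theta_j)=\sup_{\theta\in\Theta_j}l_\infty(\theta)$. The expectation $E$ and ''with probability 1'' refer to the true distribution of $Y$, which need not belong to the model. The collection $\{\log g(Y;\theta):\theta\in\Theta_j\}$ is Glivenko-Cantelli (with respect to the distribution of $Y$) if each $\log g(Y;\theta)$, $\theta\in\Theta_j$, is integrable and $$\sup_{\theta\in\Theta_j}\left|\frac1n\sum_{i=1}^n\log g(Y_i;\theta)-E\log g(Y;\theta)\right|\to0$$ with probability 1 (outer almost surely if the supremum is not measurable) as $n\to\infty$. *)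

(* Defs.v *)
From HB Require Import structures.
From mathcomp Require Import all_boot all_order all_algebra finmap.
From mathcomp Require Import all_classical all_reals all_analysis measurable_realfun.

Set Implicit Arguments.
Unset Strict Implicit.
Unset Printing Implicit Defensive.

Import Order.TTheory GRing.Theory Num.Theory.
Import numFieldNormedType.Exports.

Local Open Scope classical_set_scope.
Local Open Scope ring_scope.
Local Open Scope ereal_scope.

Definition mutually_independent (d d' : measure_display)
    (Omega : measurableType d) (T : measurableType d') (R : realType)
    (P : probability Omega R) (I : choiceType) (Y : I -> {RV P >-> T}) : Prop :=
  forall (J : {fset I}) (A : I -> set T),
    (forall i, i \in J -> measurable (A i)) ->
    P (\bigcap_(i in [set` J]) Y i @^-1` A i) = \prod_(i <- J) P (Y i @^-1` A i).

(* The sample Y_1, Y_2, ... is indexed from 0: Y_(i+1) is Ys i.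
   No independence is required between Y and the sequence, so that Y may be
   one of its members. *)
Definition independent_copies (d d' : measure_display)
    (Omega : measurableType d) (T : measurableType d') (R : realType)
    (P : probability Omega R) (Y : {RV P >-> T}) (Ys : nat -> {RV P >-> T}) :
    Prop :=
  mutually_independent Ys /\
  forall i (A : set T), measurable A ->
    distribution P (Ys i) A = distribution P Y A.

Definition is_density (d' : measure_display) (T : measurableType d')
    (R : realType) (nu : {measure set T -> \bar R}) (f : T -> R) : Prop :=
  [/\ measurable_fun [set: T] f, (forall y, (0 <= f y)%R) &
      \int[nu]_y (f y)%:E = 1].

Definition density_model (d' : measure_display) (T : measurableType d')
    (R : realType) (nu : {measure set T -> \bar R}) (Theta : Type)
    (g : T -> Theta -> R) : Prop :=
  forall theta, is_density nu (g ^~ theta).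

(* Supremum of F(A) for F >= 0, taken in the ordered set [0, +oo]: it is the
   usual supremum in \bar R when A is nonempty, and 0 when A is empty
   (where ereal_sup would give -oo). *)
Definition nneg_sup (R : realType) (Theta : Type) (A : set Theta)
    (F : Theta -> \bar R) : \bar R := supremum 0 (F @` A).

(* Outer almost sure convergence to 0 of nonnegative, possibly nonmeasurable,
   X n: the X n have measurable majorants that tend to 0 almost surely. If the
   X n are measurable this is almost sure convergence. *)
Definition outer_as_cvg0 (d : measure_display) (Omega : measurableType d)
    (R : realType) (P : probability Omega R) (X : nat -> Omega -> \bar R) :
    Prop :=
  exists D : nat -> Omega -> \bar R,
    [/\ forall n, measurable_fun [set: Omega] (D n),
        forall n w, X n w <= D n w &
        {ae P, forall w, D n w @[n --> \oo] --> 0}].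

Definition glivenko_cantelli (d d' : measure_display)
    (Omega : measurableType d) (T : measurableType d') (R : realType)
    (P : probability Omega R) (Y : {RV P >-> T}) (Ys : nat -> {RV P >-> T})
    (Theta : Type) (A : set Theta) (f : T -> Theta -> \bar R) : Prop :=
  (forall theta, A theta ->
     P.-integrable [set: Omega] (fun w => f (Y w) theta)) /\
  outer_as_cvg0 P (fun n w => nneg_sup A (fun theta =>
    `| (n%:R^-1)%:E * (\sum_(i < n) f (Ys i w) theta)
       - \int[P]_w' f (Y w') theta |)).

(* The logarithm lne has lne 0 = -oo, unlike the real ln, for which ln 0 = 0. *)
Definition log_density (d' : measure_display) (T : measurableType d')
    (R : realType) (Theta : Type) (g : T -> Theta -> R) (y : T)
    (theta : Theta) : \bar R := lne (g y theta)%:E.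

Definition likelihood (d d' : measure_display)
    (Omega : measurableType d) (T : measurableType d') (R : realType)
    (P : probability Omega R) (Ys : nat -> {RV P >-> T})
    (Theta : Type) (g : T -> Theta -> R) (n : nat) (w : Omega)
    (theta : Theta) : R := (\prod_(i < n) g (Ys i w) theta)%R.

Definition limit_loglik (d d' : measure_display)
    (Omega : measurableType d) (T : measurableType d') (R : realType)
    (P : probability Omega R) (Y : {RV P >-> T})
    (Theta : Type) (g : T -> Theta -> R) (theta : Theta) : \bar R :=
  \int[P]_w log_density g (Y w) theta.

(* In \bar R, x / 0 = +oo for x > 0 and x / +oo = 0 for x finite. *)
Definition sup_likelihood_ratio (d d' : measure_display)
    (Omega : measurableType d) (T : measurableType d') (R : realType)
    (P : probability Omega R) (Ys : nat -> {RV P >-> T})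
    (Theta : Type) (g : T -> Theta -> R) (A B : set Theta) (n : nat)
    (w : Omega) : \bar R :=
  nneg_sup A (fun theta => (likelihood Ys g n w theta)%:E)
  / nneg_sup B (fun theta => (likelihood Ys g n w theta)%:E).

(* Main.v *)
Require Import Defs.
From HB Require Import structures.
From mathcomp Require Import all_boot all_order all_algebra finmap.
From mathcomp Require Import all_classical all_reals all_analysis measurable_realfun.

Set Implicit Arguments.
Unset Strict Implicit.
Unset Printing Implicit Defensive.

Import Order.TTheory GRing.Theory Num.Theory.
Import numFieldNormedType.Exports.

Local Open Scope classical_set_scope.
Local Open Scope ring_scope.
Local Open Scope ereal_scope.

(** By [likelihood_expeR], the average log-density of the first [n] observations
    is [n^-1 * log L_n(theta)].  The Glivenko-Cantelli property says that almost
    surely it is eventually within any [e > 0] of [l(theta) = E log g(Y; theta)],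
    uniformly over the parameter set, so that there
      [exp (n (l(theta) - e)) <= L_n(theta) <= exp (n (l(theta) + e))]
    (lemma [likelihood_bounds]).  Because the band does not depend on [theta], it
    passes to suprema: [sup L_n] is eventually below [exp (n a)] for every real
    [a > sup l], and eventually above [exp (n b)] for every real [b < sup l]
    (lemma [sup_likelihood_growth]).  When the two values of [sup l] differ, two
    reals [a < b] can be placed strictly between them; the ratio of the suprema
    is then at least [exp (n (b - a))] or at most [exp (- n (b - a))]
    (lemmas [cvg_ratio_pinfty] and [cvg_ratio_0]).

    The estimates hold in [\bar R], which takes care of the degenerate cases: a
    vanishing density, an empty parameter set ([sup l = -oo], [sup L_n = 0]), and
    infinite suprema. *)

(** The likelihood at a fixed parameter is the exponential of the sum of the
    log-densities.  Since [lne 0 = -oo] and [expeR (-oo) = 0], this includes the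
    samples at which some density vanishes, where both sides are 0. *)
Lemma likelihood_expeR (d d' : measure_display) (Omega : measurableType d)
    (T : measurableType d') (R : realType) (P : probability Omega R)
    (Ys : nat -> {RV P >-> T}) (Theta : Type) (g : T -> Theta -> R) :
  (forall y theta, (0 <= g y theta)%R) -> forall n w theta,
  (likelihood Ys g n w theta)%:E =
  expeR (\sum_(i < n) log_density g (Ys i w) theta).
Proof.
move=> g0 n w theta; rewrite /likelihood -prodEFin.
rewrite (big_morph expeR expeRD expeR0); apply: eq_bigr => i _.
by rewrite /log_density lneK// in_itv/= lee_fin g0 leey.
Qed.

(** The sum [S] ranges over [\bar R]: its finiteness is part of the conclusion,
    since a mean at finite distance from a finite limit is finite.  This rules
    out the samples with an infinite log-density. *)
Lemma sum_bounds_of_mean (R : realType) (n : nat) (S l : \bar R) (e : R) :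
  (0 < n)%N -> l \is a fin_num -> `|(n%:R^-1)%:E * S - l| < e%:E ->
  n%:R%:E * (l - e%:E) <= S <= n%:R%:E * (l + e%:E).
Proof.
move=> n0 lfin; have n0' : (0 < n%:R :> R)%R by rewrite ltr0n.
rewrite lte_absl lteBrDr// lteBlDr// [- _ + l]addeC [e%:E + l]addeC.
by rewrite lte_pdivlMl// lte_pdivrMl// => /andP[/ltW -> /ltW ->].
Qed.

Lemma lte_between (R : realType) (x y : \bar R) :
  x < y -> exists r : R, x < r%:E < y.
Proof.
case: x => [x| |]; case: y => [y| |] //=.
- by move=> xy; exists ((x + y) / 2)%R; rewrite !lte_fin !midf_lt.
- by move=> _; exists (x + 1)%R; rewrite lte_fin ltrDl ltr01 ltry.
- by move=> _; exists (y - 1)%R; rewrite lte_fin gtrBl ltr01 ltNyr.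
- by move=> _; exists 0%R; rewrite ltNyr ltry.
Qed.

Section nneg_sup.
Context (R : realType) (Theta : Type) (A : set Theta) (F : Theta -> \bar R).

Lemma nneg_sup_ge theta : A theta -> F theta <= nneg_sup A F.
Proof.
move=> At; apply: ge_supremum_Nmem; last by exists theta.
exact: ereal_supremums_neq0.
Qed.

Lemma nneg_sup_le x :
  0 <= x -> (forall theta, A theta -> F theta <= x) -> nneg_sup A F <= x.
Proof.
move=> x0 Fx; have [A0|/set0P[theta At]] := eqVneq A set0.
  by rewrite /nneg_sup A0 image_set0 supremum0.
rewrite /nneg_sup /supremum ifF; last first.
  by apply/negbTE/set0P; exists (F theta), theta.
have [_ least] := xgetPex 0 (ereal_supremums_neq0 (F @` A)).
by apply: least => _ [t /Fx ? <-].
Qed.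

Lemma nneg_sup_ge0 : (forall theta, 0 <= F theta) -> 0 <= nneg_sup A F.
Proof.
move=> F0; have [A0|/set0P[theta At]] := eqVneq A set0.
  by rewrite /nneg_sup A0 image_set0 supremum0.
exact: le_trans (nneg_sup_ge At).
Qed.

End nneg_sup.

Lemma EFin_expRN (R : realType) (x : R) :
  (expR (- x))%:E = (expR x)%:E^-1.
Proof. by rewrite expRN inver gt_eqF// expR_gt0. Qed.

(** Two sequences separated by different exponential rates.  They take values in
    [\bar R] because a supremum of likelihoods may be [+oo], where the inverse is
    0, or vanish, where the inverse is [+oo]; the inverse is antitone on all of
    [[0, +oo]], so both cases obey the estimate of the finite one. *)
Section ratio.
Context (R : realType) (a b : R) (U V : nat -> \bar R).
Hypothesis ab : (a < b)%R.
Hypothesis U_le : \forall n \near \oo, 0 <= U n <= (expR (n%:R * a))%:E.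
Hypothesis V_ge : \forall n \near \oo, (expR (n%:R * b))%:E <= V n.

Lemma cvg_ratio_0 : U n / V n @[n --> \oo] --> 0.
Proof.
apply: (@squeeze_cvge _ _ _ _ (cst 0) _
  (fun n => (expR (a - b) ^+ n)%:E)); last 2 first.
- exact: cvg_cst.
- apply: cvg_EFin; first by near=> n.
  by apply: cvg_expr; rewrite ger0_norm ?expR_ge0// -expR0 ltr_expR subr_lt0.
near=> n.
have /andP[U0 Ua] : 0 <= U n <= (expR (n%:R * a))%:E by near: n.
have bV : (expR (n%:R * b))%:E <= V n by near: n.
have V0 : 0 <= V n by apply: le_trans bV; rewrite lee_fin expR_ge0.
rewrite mule_ge0 ?inve_ge0//=.
rewrite -expRM_natl mulrBr expRD EFinM EFin_expRN.
by apply: lee_pmul; rewrite ?inve_ge0// lee_pV2 ?inE// lee_fin expR_ge0.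
Unshelve. all: by end_near. Qed.

Lemma cvg_ratio_pinfty : V n / U n @[n --> \oo] --> +oo.
Proof.
(* The linear minorant [1 + x <= expR x] is enough for divergence. *)
have lin : (n%:R * (b - a))%:E @[n --> \oo] --> +oo.
  apply/cvgeryP.
  apply: (cvg_comp (fun n : nat => n%:R : R) ( *%R ^~ (b - a)%R) cvgr_idn).
  by apply: gt0_cvgMly; [rewrite subr_gt0 | exact: cvg_id].
apply: gee_cvgy lin.
near=> n.
have /andP[U0 Ua] : 0 <= U n <= (expR (n%:R * a))%:E by near: n.
have bV : (expR (n%:R * b))%:E <= V n by near: n.
apply: (@le_trans _ _ (expR (n%:R * (b - a)))%:E).
  by rewrite lee_fin; apply: le_trans (expR_ge1Dx _); rewrite lerDr.
rewrite mulrBr expRD EFinM EFin_expRN.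
apply: lee_pmul; rewrite ?inve_ge0 ?lee_fin ?expR_ge0//.
by rewrite lee_pV2 ?inE// lee_fin expR_ge0.
Unshelve. all: by end_near. Qed.

End ratio.

Section growth.
Context (d d' : measure_display) (Omega : measurableType d)
    (T : measurableType d') (R : realType) (P : probability Omega R)
    (Y : {RV P >-> T}) (Ys : nat -> {RV P >-> T})
    (Theta : Type) (g : T -> Theta -> R) (A : set Theta).
Hypothesis g_ge0 : forall y theta, (0 <= g y theta)%R.
Hypothesis GC : glivenko_cantelli Y Ys A (log_density g).

Let L n w theta := (likelihood Ys g n w theta)%:E.
Let l := limit_loglik Y g.

Lemma limit_loglik_fin theta : A theta -> l theta \is a fin_num.
Proof. by move=> At; exact: integrable_fin_num (GC.1 _ At). Qed.

(** The exceptional null set is that of the measurable majorant of the uniform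
    deviation, hence common to all [e] and [theta]. *)
Lemma likelihood_bounds :
  {ae P, forall w, forall e : R, (0 < e)%R -> \forall n \near \oo,
    forall theta, A theta ->
      expeR (n%:R%:E * (l theta - e%:E)) <= L n w theta
        <= expeR (n%:R%:E * (l theta + e%:E))}.
Proof.
have [D [_ XD D0]] := GC.2.
apply: filterS D0 => w D0 e e0.
have De : \forall n \near \oo, D n w < e%:E.
  by apply: (D0 [set x | x < e%:E]); apply: open_ereal_lt'; rewrite lte_fin.
near=> n => theta At.
rewrite /L likelihood_expeR// !lee_expeR.
apply: sum_bounds_of_mean; [by near: n; exists 1%N| exact: limit_loglik_fin|].
apply: (@le_lt_trans _ _ (D n w)); last by near: n.
apply: le_trans (XD n w).
exact: (nneg_sup_ge (fun theta =>
  `|_ * \sum_(i < n) log_density g (Ys i w) theta - l theta|)).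
Unshelve. all: by end_near. Qed.

(** The supremum [sup L_n] grows at the exponential rate [sup l].  Two one-sided
    statements with real rates replace a limit of [n^-1 * log sup L_n], so that
    [sup l = -oo] and [sup l = +oo] need no separate treatment.  The upper bound
    needs the band for all parameters at once; the lower bound needs one
    parameter whose [l] exceeds [b]. *)
Lemma sup_likelihood_growth :
  {ae P, forall w,
    (forall a : R, ereal_sup (l @` A) < a%:E -> \forall n \near \oo,
      0 <= nneg_sup A (L n w) <= (expR (n%:R * a))%:E) /\
    (forall b : R, b%:E < ereal_sup (l @` A) -> \forall n \near \oo,
      (expR (n%:R * b))%:E <= nneg_sup A (L n w))}.
Proof.
apply: filterS likelihood_bounds => w bnd; split => [a|b].
- move=> /lte_between[c /andP[lc]]; rewrite lte_fin => ca.
  (* The uniform error [a - c] fits in the room left between [sup l] and [a]. *)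
  have := bnd (a - c)%R; rewrite subr_gt0 => /(_ ca).
  apply: filterS => n Lle; apply/andP; split.
    apply: nneg_sup_ge0 => theta; rewrite lee_fin.
    by apply: prodr_ge0 => i _; exact: g_ge0.
  apply: nneg_sup_le => [|theta At]; first by rewrite lee_fin expR_ge0.
  have /andP[_ /le_trans] := Lle _ At; apply.
  have lt : l theta <= c%:E.
    by apply: le_trans (ltW lc); apply: ereal_sup_ubound; exists theta.
  rewrite -[leRHS]/(expeR (n%:R%:E * a%:E)) lee_expeR lee_wpmul2l ?lee_fin//.
  by rewrite (le_trans (leeD2r _ lt))// -EFinD subrKC.
- move=> /ereal_sup_gt[_ [theta At <-] bl].
  have lfin := limit_loglik_fin At.
  have := bnd (fine (l theta) - b)%R; rewrite subr_gt0.
  rewrite -lte_fin fineK// => /(_ bl).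
  apply: filterS => n /(_ _ At) /andP[Lge _].
  apply: le_trans (nneg_sup_ge _ At); apply: le_trans Lge.
  rewrite -[leLHS]/(expeR (n%:R%:E * b%:E)) lee_expeR lee_wpmul2l ?lee_fin//.
  by rewrite -(fineK lfin) lee_fin opprB addrC subrK.
Qed.

End growth.

Theorem theorem2 (d d' : measure_display) (Omega : measurableType d)
    (T : measurableType d') (R : realType) (P : probability Omega R)
    (Y : {RV P >-> T}) (Ys : nat -> {RV P >-> T})
    (hYs : independent_copies Y Ys)
    (nu : {measure set T -> \bar R}) (Theta : Type) (g : T -> Theta -> R)
    (hg : density_model nu g)
    (Theta1 Theta2 : set Theta)
    (hGC1 : glivenko_cantelli Y Ys Theta1 (log_density g))
    (hGC2 : glivenko_cantelli Y Ys Theta2 (log_density g)) :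
  {ae P, forall w,
    (ereal_sup (limit_loglik Y g @` Theta2)
       < ereal_sup (limit_loglik Y g @` Theta1) ->
     sup_likelihood_ratio Ys g Theta1 Theta2 n w @[n --> \oo] --> +oo) /\
    (ereal_sup (limit_loglik Y g @` Theta1)
       < ereal_sup (limit_loglik Y g @` Theta2) ->
     sup_likelihood_ratio Ys g Theta1 Theta2 n w @[n --> \oo] --> 0)}.
Proof.
have g0 y theta : (0 <= g y theta)%R by have [_ + _] := hg theta; apply.
apply: filterS2 (sup_likelihood_growth g0 hGC1) (sup_likelihood_growth g0 hGC2).
move=> w [ub1 lb1] [ub2 lb2].
split => /lte_between[a /andP[lo /lte_between[b /andP[ab hi]]]].
- exact: (cvg_ratio_pinfty ab (ub2 a lo) (lb1 b hi)).
- exact: (cvg_ratio_0 ab (ub1 a lo) (lb2 b hi)).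
Qed.
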